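(* In the finite one-way scheme with two groups (see context), over $\mathsf\Omega_{\mathrm{full}}$ and for any $M$ and $S$, let $$\mathcal C_1=\{h\in C^0:h_{\omega_1}=0\}$$ be the class of corrections which leave the component at the merged design unchanged. Then $\mathcal C_1\cap\mathrm{Nat}(B,A)=0$, so that a correction in $\mathcal C_1$ is unique when it exists. A deterministic raw family $g=(g_{\omega_1},g_{\omega_2})$ with target constant at $T$ has a correction in $\mathcal C_1$ if and only if $g_{\omega_1}$ does not depend on the mean, i.e. if and only if $g_{\omega_1}\circ\Theta(i_1)=g_{\omega_1}\circ\Theta(i_2)$. In this case the corrected family is deterministic, with component $g_{\omega_1}\circ\Theta(i_1)$ at $\omega_2$. For the marginal dispersion, the corrected component at $\omega_2$ is the within-group dispersion $((\mu_1,\mu_2),s)\mapsto s$.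
   Context: $\mathsf\Omega_{\mathrm{full}}$ is the full subcategory of finite sets on the two objects $\omega_1=\{*\}$ (merged design) and $\omega_2=\{1,2\}$; its non-identity morphisms are the merge $p:\omega_2\to\omega_1$, the selections $i_1,i_2:\omega_1\to\omega_2$ ($i_k( * )=k$), the swap $\sigma$ of $\omega_2$, and the constants $c_k=i_kp$. $M\subset\mathbb Q$ (means) and $S\subset\mathbb Q_{>0}$ (dispersions) are finite non-empty sets; $\Theta(\omega)=M^\omega\times S$ with $\Theta(\psi)(\mu',s)=(\mu'\circ\psi,s)$, so $\Theta(p)(\mu,s)=((\mu,\mu),s)$, $\Theta(i_k)((\mu_1,\mu_2),s)=(\mu_k,s)$. The marginal dispersion is $g_{\omega_1}(\mu,s)=s$, $g_{\omega_2}((\mu_1,\mu_2),s)=s+(\mu_1-\mu_2)^2/4$, and $T=\{s+(\mu_1-\mu_2)^2/4\}$ is the (finite) set of values of its component at $\omega_2$, which contains $S$. The target $\Lambda$ is constant at $T$ with $\Lambda(\psi)=\mathrm{id}_T$. Let $k\supseteq\mathbb Q$ be a field, $A(\omega)=k^{\Theta(\omega)}$ with $A(\psi)=\Theta(\psi)^*$ (precomposition), $B(\omega)=k^T$ with $B(\psi)=\mathrm{id}$. $C^0=\prod_\omega\mathrm{Hom}_k(B(\omega),A(\omega))$ ($k$-linear maps) and, for $h\in C^0$ and $\psi:\omega\to\omega'$, $(d^0h)(\psi)=A(\psi)h_\omega-h_{\omega'}B(\psi)$; $\mathrm{Nat}(B,A)=\ker d^0$, and elements of it are called natural. A deterministic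 raw family with target constant at $T$ is any pair of maps $g_{\omega}:\Theta(\omega)\to T$, $\omega\in\{\omega_1,\omega_2\}$; $g^*=(g_\omega^* )_\omega\in C^0$ is the family of precompositions. A correction of $g$ in $\mathcal C_1$ is $h\in\mathcal C_1$ with $g^*+h$ natural; the corrected family is $g^*+h$, and it is called deterministic, with components $f_\omega$, if $g^*+h=(f_\omega^* )_\omega$ for maps $f_\omega:\Theta(\omega)\to T$. *)

(* Defs.v *)
From HB Require Import structures.
From mathcomp Require Import all_boot all_order all_algebra finmap.

Set Implicit Arguments.
Unset Strict Implicit.
Unset Printing Implicit Defensive.

Import Order.TTheory GRing.Theory Num.Theory.

Local Open Scope fset_scope.
Local Open Scope ring_scope.

(* The full subcategory of finite sets on a one-element and a two-element set;
   the group labels 1 and 2 are encoded as ord0 and ord_max in 'I_2. *)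
Inductive design := omega1 | omega2.

Definition elt (w : design) : finType :=
  match w with omega1 => unit : finType | omega2 => 'I_2 : finType end.

Definition hom (w w' : design) := {ffun elt w -> elt w'}.

Definition group1 : elt omega2 := ord0.
Definition group2 : elt omega2 := ord_max.

Definition i1 : hom omega1 omega2 := [ffun=> group1].
Definition i2 : hom omega1 omega2 := [ffun=> group2].

Section Scheme.
Variables M S : {fset rat}.

Definition Theta (w : design) : finType := ({ffun elt w -> M} * S)%type.

Definition Theta_map (w w' : design) (psi : hom w w') (th : Theta w') :
    Theta w :=
  ([ffun x => th.1 (psi x)], th.2).

Definition dispersion (w : design) : Theta w -> rat :=
  match w with
  | omega1 => fun th : Theta omega1 => val th.2
  | omega2 => fun th : Theta omega2 =>
      val th.2 + (val (th.1 group1) - val (th.1 group2)) ^+ 2 / 4%:R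
  end.

Definition T : {fset rat} := [fset dispersion th | th in Theta omega2].

Lemma dispersion_in_T (w : design) (th : Theta w) : dispersion th \in T.
Proof.
case: w th => th; last by apply/imfsetP; exists th.
apply/imfsetP; exists (([ffun=> th.1 tt], th.2) : Theta omega2) => //=.
by rewrite !ffunE subrr expr0n /= mul0r addr0.
Qed.

Definition raw_family := forall w : design, Theta w -> T.

Definition marginal_dispersion : raw_family :=
  fun w th => [` dispersion_in_T th].

Definition mean_independent (g1 : Theta omega1 -> T) :=
  forall (mu mu' : {ffun elt omega1 -> M}) (s : S), g1 (mu, s) = g1 (mu', s).

End Scheme.

Section Precomposition.
Variables (k : fieldType) (X Y : finType) (f : X -> Y).

Definition precomp_fun (phi : {ffun Y -> k^o}) : {ffun X -> k^o} :=
  [ffun x => phi (f x)].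

Fact precomp_fun_linear : linear precomp_fun.
Proof. by move=> a u v; apply/ffunP=> x; rewrite !ffunE. Qed.

HB.instance Definition _ :=
  GRing.isLinear.Build k {ffun Y -> k^o} {ffun X -> k^o} _ precomp_fun
    precomp_fun_linear.

Definition precomp : 'Hom({ffun Y -> k^o}, {ffun X -> k^o}) :=
  linfun precomp_fun.

Lemma precompE (phi : {ffun Y -> k^o}) (x : X) : precomp phi x = phi (f x).
Proof. by rewrite lfunE ffunE. Qed.

End Precomposition.

Section Cochains.
Variables (k : fieldType) (M S : {fset rat}).

Definition A (w : design) : vectType k := {ffun Theta M S w -> k^o}.

Definition A_map (w w' : design) (psi : hom w w') : 'Hom(A w, A w') :=
  precomp k (@Theta_map M S w w' psi).

Definition B (w : design) : vectType k := {ffun T M S -> k^o}.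

Definition B_map (w w' : design) (psi : hom w w') : 'Hom(B w, B w') := \1%VF.

(* Elements of the product over the two designs are compared componentwise. *)
Definition C0 := forall w : design, 'Hom(B w, A w).

Definition d0 (h : C0) (w w' : design) (psi : hom w w') : 'Hom(B w, A w') :=
  (A_map psi \o h w)%VF - (h w' \o B_map psi)%VF.

Definition natural (h : C0) :=
  forall (w w' : design) (psi : hom w w'), d0 h psi = 0.

Definition pullback (g : raw_family M S) : C0 := fun w => precomp k (g w).

Definition corrected (g : raw_family M S) (h : C0) : C0 :=
  fun w => pullback g w + h w.

Definition C1 (h : C0) := h omega1 = 0.

Definition correction (C : C0 -> Prop) (g : raw_family M S) (h : C0) :=
  C h /\ natural (corrected g h).

Definition deterministic_with (c : C0) (f : raw_family M S) :=
  forall w : design, c w = pullback f w.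

End Cochains.

(* Main.v *)
Require Import Defs.
From mathcomp Require Import all_boot all_order all_algebra finmap.

Set Implicit Arguments.
Unset Strict Implicit.
Unset Printing Implicit Defensive.

Import Order.TTheory GRing.Theory Num.Theory.

Local Open Scope fset_scope.
Local Open Scope ring_scope.

(** Every design receives a map from the merged design, so a natural family is
    determined by its component there: evaluating naturality along the
    selection [i1] gives [c omega2 = A_map i1 \o c omega1]
    ([natural_determined]).  A correction in [C1] fixes the component
    [pullback g omega1], so it is unique, and the corrected component at
    [omega2] is forced to be precomposition with
    [g omega1 \o Theta_map i1] ([corrected_deterministic]).

    Using [i2] instead of [i1] gives the obstruction.  The two expressions
    must agree on every function on the target, and functions on a finite set
    separate points (through the indicators, since 1 is nonzero in a field),
    whence [g omega1 \o Theta_map i1 = g omega1 \o Theta_map i2].  As every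
    pair of merged means is the pair of selections of one two-group mean, this
    equation says exactly that [g omega1] ignores the mean
    ([mean_independentP]).

    Conversely, every [Theta_map psi] preserves the dispersion coordinate.  If
    [g omega1] only depends on that coordinate, then so does the family which
    evaluates [g omega1] at the first group, and this family is invariant under
    all [Theta_map psi], that is, its pullback is natural
    ([spread_natural]).  The marginal dispersion at the merged design is the
    dispersion coordinate itself, which makes the corrected component at
    [omega2] the within-group dispersion. *)

Section Naturality.
Variables (k : fieldType) (M S : {fset rat}).
Implicit Types (c h : C0 k M S) (f g : raw_family M S).

(** The type annotation exposes the space [A w] as functions, which its packing
    as a vector space hides from the coercion to functions. *)
Definition eval_at c (w : design) (phi : {ffun T M S -> k^o})
    (th : Theta M S w) : k :=
  (c w phi : {ffun Theta M S w -> k^o}) th.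

Lemma eval_at_ext c c' (w : design) :
  (forall phi (th : Theta M S w), eval_at c phi th = eval_at c' phi th) ->
  c w = c' w.
Proof. by move=> ecc'; apply/lfunP=> phi; apply/ffunP=> th; exact: ecc'. Qed.

Lemma eval_at_pullback f (w : design) (phi : {ffun T M S -> k^o})
    (th : Theta M S w) :
  eval_at (pullback k f) phi th = phi (f w th).
Proof. exact: precompE. Qed.

Lemma naturalP c :
  natural c <->
  forall (w w' : design) (psi : Defs.hom w w') phi (th : Theta M S w'),
    eval_at c phi th = eval_at c phi (Theta_map psi th).
Proof.
split=> [nat_c w w' psi phi th | nat_c w w' psi].
  move/eqP: (nat_c _ _ psi); rewrite subr_eq0 => /eqP/lfunP/(_ phi)/ffunP/(_ th).
  by rewrite !comp_lfunE id_lfunE precompE.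
apply/eqP; rewrite subr_eq0; apply/eqP/lfunP=> phi; apply/ffunP=> th.
by rewrite !comp_lfunE id_lfunE precompE; apply/esym/nat_c.
Qed.

Lemma natural_pullback f :
  (forall (w w' : design) (psi : Defs.hom w w') (th : Theta M S w'),
     f w' th = f w (Theta_map psi th)) ->
  natural (pullback k f).
Proof.
by move=> inv_f; apply/naturalP=> w w' psi phi th; rewrite !eval_at_pullback (inv_f _ _ psi).
Qed.

Lemma natural0 c : (forall w, c w = 0) -> natural c.
Proof. by move=> c0 w w' psi; rewrite /d0 !c0 comp_lfun0r comp_lfun0l subrr. Qed.

(** Naturality along [i1] expresses the component at [omega2] through the one at
    [omega1]. *)
Lemma natural_determined c c' :
  natural c -> natural c' -> c omega1 = c' omega1 -> forall w, c w = c' w.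
Proof.
move=> /naturalP nat_c /naturalP nat_c' e1 [//|]; apply: eval_at_ext => phi th.
by rewrite (nat_c _ _ i1) (nat_c' _ _ i1) /eval_at e1.
Qed.

(** The indicator of [y] separates [x] from [y] because 1 is nonzero in [k]. *)
Lemma ffun_separates_points (X : finType) (x y : X) :
  (forall phi : {ffun X -> k^o}, phi x = phi y) -> x = y.
Proof.
move=> /(_ [ffun z => (z == y)%:R]); rewrite !ffunE eqxx.
by case: eqP => // _ /eqP; rewrite eq_sym oner_eq0.
Qed.

Lemma corrected_omega1 g h :
  C1 h -> corrected g h omega1 = pullback k g omega1.
Proof. by move=> h1; rewrite /corrected h1 addr0. Qed.

Lemma correction_unique g h h' :
  correction (@C1 k M S) g h -> correction (@C1 k M S) g h' ->
  forall w, h w = h' w.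
Proof.
move=> [h1 nat_h] [h'1 nat_h'] w; apply: (@addrI _ (pullback k g w)).
by apply: (natural_determined nat_h nat_h'); rewrite !corrected_omega1.
Qed.

(** The means selected from one two-group parameter are arbitrary, so
    comparing [i1] with [i2] compares all pairs of merged means. *)
Lemma mean_independentP (g1 : Theta M S omega1 -> T M S) :
  mean_independent g1 <-> g1 \o Theta_map i1 =1 g1 \o Theta_map i2.
Proof.
split=> [ind th | sel mu mu' s]; first exact: ind.
pose th : Theta M S omega2 :=
  ([ffun x => if x == group1 then mu tt else mu' tt], s).
have -> : (mu, s) = Theta_map i1 th.
  by congr pair; apply/ffunP=> -[]; rewrite !ffunE eqxx.
have -> : (mu', s) = Theta_map i2 th.
  by congr pair; apply/ffunP=> -[]; rewrite !ffunE.
exact: sel.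
Qed.

(** The corrected component at [omega2] is the pullback of the fixed component
    at [omega1] along [i1] and also along [i2]; functions on the target then
    detect that the two selections of [g omega1] agree. *)
Lemma correction_mean_independent g h :
  correction (@C1 k M S) g h -> mean_independent (g omega1).
Proof.
case=> h1 /naturalP nat_c; apply/mean_independentP=> th.
apply: ffun_separates_points => phi.
move: (nat_c _ _ i1 phi th); rewrite (nat_c _ _ i2 phi th).
rewrite /eval_at (corrected_omega1 g h1).
by rewrite -!/(eval_at (pullback k g) _ _) !eval_at_pullback.
Qed.

(** The only candidate for a corrected family: naturality along [i1] forces its
    component at [omega2]. *)
Definition spread g : raw_family M S := fun w =>
  match w with
  | omega1 => g omega1
  | omega2 => g omega1 \o Theta_map i1
  end.

(** [Theta_map psi] changes the means but keeps the dispersion, so both sides of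
    the invariance equation are values of [g omega1] at the same dispersion. *)
Lemma spread_natural g :
  mean_independent (g omega1) -> natural (pullback k (spread g)).
Proof.
move=> ind; apply: natural_pullback => -[] [] psi [mu s]; exact: ind.
Qed.

Lemma corrected_deterministic g h :
  correction (@C1 k M S) g h -> deterministic_with (corrected g h) (spread g).
Proof.
move=> corr; have ind := correction_mean_independent corr.
case: corr => h1 nat_c; apply: (natural_determined nat_c (spread_natural ind)).
exact: corrected_omega1.
Qed.

Lemma correction_exists g :
  mean_independent (g omega1) -> exists h, correction (@C1 k M S) g h.
Proof.
move=> ind; pose h w := pullback k (spread g) w - pullback k g w.
have corrE w : corrected g h w = pullback k (spread g) w by apply: subrKC.
exists h; split=> [|w w' psi]; first exact: subrr.
by rewrite /d0 !corrE; exact: spread_natural.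
Qed.

End Naturality.

Theorem proposition6p8 (k : fieldType) (iota : {rmorphism rat -> k})
    (M S : {fset rat}) (M_neq0 : M != fset0) (S_neq0 : S != fset0)
    (S_gt0 : forall s : rat, s \in S -> 0 < s) :
  (forall h : C0 k M S,
     (C1 h /\ natural h) <-> (forall w : design, h w = 0)) /\
  (forall (g : raw_family M S) (h h' : C0 k M S),
     correction (@C1 k M S) g h -> correction (@C1 k M S) g h' ->
     forall w : design, h w = h' w) /\
  (forall g : raw_family M S,
     ((exists h : C0 k M S, correction (@C1 k M S) g h) <->
        mean_independent (g omega1)) /\
     (mean_independent (g omega1) <->
        g omega1 \o Theta_map i1 =1 g omega1 \o Theta_map i2)) /\
  (forall (g : raw_family M S) (h : C0 k M S),
     correction (@C1 k M S) g h ->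
     exists f : raw_family M S,
       deterministic_with (corrected g h) f /\
       f omega2 =1 g omega1 \o Theta_map i1) /\
  (exists h : C0 k M S,
     correction (@C1 k M S) (marginal_dispersion (M:=M) (S:=S)) h /\
     exists f : raw_family M S,
       deterministic_with (corrected (marginal_dispersion (M:=M) (S:=S)) h) f /\
       forall th : Theta M S omega2, val (f omega2 th) = val th.2).
Proof.
split=> [h|].
  split=> [[h1 nat_h] | h0]; last by split; [exact: h0 | exact: natural0].
  pose z : C0 k M S := fun=> 0.
  by apply: (natural_determined (c' := z)) => //; exact: natural0.
split; first exact: correction_unique.
split=> [g|].
  split; last exact: mean_independentP.
  by split=> [[h /correction_mean_independent] | /correction_exists].
split=> [g h corr|].
  by exists (spread g); split; first exact: corrected_deterministic.
have ind : mean_independent (@marginal_dispersion M S omega1).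
  by move=> mu mu' s; apply: val_inj.
have [h corr] := correction_exists k ind.
exists h; split=> //; exists (spread (@marginal_dispersion M S)).
by split; first exact: corrected_deterministic.
Qed.
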